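(* For every integer $n\ge1$ and every subset $A\subseteq X_n$, the integer $R_n(A)$ is exactly the number of truncated profiles $r=(r_2,\ldots,r_n)$, $r_k\in\mathbb Z/k\mathbb Z$, such that $S_n(r)=A$. Consequently, \[ A\in\mathcal F_n\quad\Longleftrightarrow\quad R_n(A)>0, \] and hence \[ N(n)=\sum_{A\subseteq X_n}\min\{1,R_n(A)\}. \]
   Context: For an integer $n\ge 1$ let $X_n=\{2,3,\ldots,n+1\}$. A truncated profile of length $n$ is a tuple $r=(r_2,\ldots,r_n)$ with $r_k\in\mathbb Z/k\mathbb Z$ for each $2\le k\le n$ (the empty tuple if $n=1$). Its survivor set is \[ S_n(r)=\{m\in X_n:\ m\not\equiv r_k\pmod k\text{ for every } 2\le k<m\}. \] Let $\mathcal F_n=\{S_n(r): r \text{ a truncated profile of length } n\}$ and $N(n)=|\mathcal F_n|$. For $B\subseteq X_n$ and $2\le k\le n$ define $\nu_k(B)=\#\{b\bmod k:\ b\in B,\ b>k\}$, the number of distinct residue classes modulo $k$ represented by elements of $B$ larger than $k$. For $A\subseteq X_n$ put \[ R_n(A)=\sum_{Y\subseteq X_n\setminus A}(-1)^{|Y|}\prod_{k=2}^{n}\bigl(k-\nu_k(A\cup Y)\bigr), \] where empty products equal $1$. *)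

(* Defs.v *)
From HB Require Import structures.
From mathcomp Require Import all_boot all_order all_algebra.
Set Implicit Arguments.
Unset Strict Implicit.
Unset Printing Implicit Defensive.
Import Order.TTheory GRing.Theory Num.Theory.
Local Open Scope ring_scope.

(* X_n = {2, ..., n+1}; its subsets are the A : {set 'I_n.+2} (values 0..n+1)
   with A \subset ground n. *)
Definition ground (n : nat) : {set 'I_n.+2} := [set m : 'I_n.+2 | (2 <= m)%N].

(* The modulus k in {2, ..., n} is represented by i : 'I_n.-1 with k = i.+2,
   so r i is the residue r_k, and n = 1 gives the single empty profile. *)
Definition profile (n : nat) := {dffun forall i : 'I_n.-1, 'Z_(i.+2)}.

Definition survivors (n : nat) (r : profile n) : {set 'I_n.+2} :=
  [set m in ground n |
    [forall i : 'I_n.-1, (i.+2 < m)%N ==> ((m : nat)%:R != r i)]].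

Definition survivor_family (n : nat) : {set {set 'I_n.+2}} :=
  [set survivors r | r : profile n].

Definition num_survivor_sets (n : nat) : nat := #|survivor_family n|.

(* Only meaningful for 2 <= k, since 'Z_0 and 'Z_1 are both the integers mod 2. *)
Definition nu (n k : nat) (B : {set 'I_n.+2}) : nat :=
  #|[set ((b : nat)%:R : 'Z_k) | b : 'I_n.+2 in B & (k < b)%N]|.

Definition Rcount (n : nat) (A : {set 'I_n.+2}) : int :=
  \sum_(Y : {set 'I_n.+2} | Y \subset ground n :\: A)
    (-1) ^+ #|Y| * \prod_(2 <= k < n.+1) (k%:Z - (nu k (A :|: Y))%:Z).

(* Main.v *)
Require Import Defs.
From HB Require Import structures.
From mathcomp Require Import all_boot all_order all_algebra.
Import Order.TTheory GRing.Theory Num.Theory.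
Local Open Scope ring_scope.

(** For B in the ground set, a profile r satisfies [B \subset survivors r] iff,
    for each modulus k separately, r_k avoids the nu_k(B) residue classes met
    by the elements of B above k. These conditions are independent, so exactly
    [\prod_k (k - nu_k(B))] profiles qualify ([card_profiles_sub_survivors]).
    The number of profiles whose survivor set is exactly A then follows by
    inclusion-exclusion over the extra survivors Y ([card_fiber_subset]), which
    rests on the vanishing of the alternating sum over the subsets of a nonempty
    set. The two other claims only use that A is a survivor set iff its fiber
    under [survivors] is nonempty. *)

Lemma alternating_sum_subsets (T : finType) (D : {set T}) :
  \sum_(Y : {set T} | Y \subset D) (-1) ^+ #|Y| = (D == set0)%:R :> int.
Proof.
(* Expand the product over i of (1 - [i \in D]). *)
transitivity (\prod_(i : T) ((if i \in D then -1 else 0) + 1) : int).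
  rewrite bigA_distr big_mkcond /=; apply: eq_bigr => Y _.
  case: ifPn => [/subsetP sYD | /subsetPn[i iY iD]].
    rewrite -prodr_const big_mkcond /=; apply: eq_bigr => i _.
    by case: ifP => // /sYD ->.
  by rewrite (bigD1 i) //= iY (negPf iD) mul0r.
case: eqP => [-> | /eqP/set0Pn[i iD]].
  by rewrite big1 // => i _; rewrite inE add0r.
by rewrite (bigD1 i) //= iD addNr mul0r.
Qed.

(** Inclusion-exclusion for a set-valued map f: the number of points mapped
    exactly to A, from the numbers of points mapped to supersets. *)
Lemma card_fiber_subset (P T : finType) (f : P -> {set T}) (U A : {set T}) :
    (forall r, f r \subset U) ->
  #|[set r | f r == A]|%:Z =
    \sum_(Y : {set T} | Y \subset U :\: A)
      (-1) ^+ #|Y| * #|[set r | A :|: Y \subset f r]|%:Z.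
Proof.
move=> fU.
have cardE (p : pred P) : #|[set r | p r]|%:Z = \sum_r (p r)%:R.
  rewrite -sum1dep_card -natz natr_sum big_mkcond.
  by apply: eq_bigr => r _; case: (p r).
rewrite cardE.
under [RHS]eq_bigr => Y _ do rewrite cardE mulr_sumr.
rewrite exchange_big /=; apply: eq_bigr => r _.
have [sAf | nAf] := boolP (A \subset f r); last first.
  rewrite big1 => [|Y _]; last by rewrite subUset (negPf nAf) mulr0.
  by case: eqP nAf => // ->; rewrite subxx.
have ->: (f r == A) = (f r :\: A == set0) by rewrite setD_eq0 eqEsubset sAf andbT.
rewrite -alternating_sum_subsets big_mkcond [RHS]big_mkcond /=.
apply: eq_bigr => Y _; rewrite subUset sAf !subsetD /=.
case: (boolP (Y \subset f r)) => [sYf | _]; last first.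
  by rewrite mulr0; case: ifP.
by rewrite (subset_trans sYf (fU r)) mulr1.
Qed.

Lemma survivors_sub_ground n (r : profile n) : survivors r \subset ground n.
Proof. by apply/subsetP => m; rewrite !inE => /andP[]. Qed.

(** The residue classes modulo k met by the elements of B larger than k, so that
    [nu k B] is its cardinality; faithful for k at least 2, where 'Z_k is the
    ring of integers modulo k. *)
Definition residues {n : nat} (k : nat) (B : {set 'I_n.+2}) : {set 'Z_k} :=
  [set ((b : nat)%:R : 'Z_k) | b : 'I_n.+2 in B & (k < b)%N].

Lemma sub_survivorsE n (B : {set 'I_n.+2}) (r : profile n) :
    B \subset ground n ->
  (B \subset survivors r) =
    (r \in family (fun i : 'I_n.-1 => [predC residues i.+2 B])).
Proof.
move=> sB; apply/subsetP/familyP => [sBr i | fr m mB].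
  rewrite inE; apply/imsetP => -[b /[!inE] /andP[bB ib] rE].
  move: (sBr b bB); rewrite inE => /andP[_ /forallP/(_ i)].
  by rewrite ib -rE eqxx.
rewrite inE (subsetP sB) //=; apply/forallP => i; apply/implyP => im.
apply: contraTneq (fr i) => mr; rewrite inE negbK -mr.
by apply/imsetP; exists m; rewrite // !inE mB.
Qed.

Lemma card_profiles_sub_survivors n (B : {set 'I_n.+2}) :
    B \subset ground n ->
  #|[set r : profile n | B \subset survivors r]|%:Z =
    \prod_(2 <= k < n.+1) (k%:Z - (nu k B)%:Z).
Proof.
move=> sB.
pose F (i : 'I_n.-1) : pred 'Z_i.+2 := [predC residues i.+2 B].
have -> : #|[set r : profile n | B \subset survivors r]| =
          #|(family F : simpl_pred {dffun forall i : 'I_n.-1, 'Z_i.+2})|.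
  by apply: eq_card => r; rewrite inE sub_survivorsE.
rewrite card_family foldrE big_map big_enum /=.
rewrite -natz natr_prod -{1}[2%N]add0n big_addn subSS subn1 big_mkord /=.
apply: eq_bigr => i _; rewrite addn2.
(* The residues met and the residues allowed partition 'Z_k, where k = i.+2. *)
have cC : (nu i.+2 B + #|F i| = i.+2)%N by rewrite cardC card_ord.
by rewrite -[X in X%:Z - _]cC PoszD addrC addKr natz.
Qed.

Lemma Rcount_card n (A : {set 'I_n.+2}) : A \subset ground n ->
  Rcount A = #|[set r : profile n | survivors r == A]|%:Z.
Proof.
move=> sA; rewrite (card_fiber_subset _ _ _ _ _ (survivors_sub_ground n)).
apply: eq_bigr => Y /subsetDP[sY _].
by rewrite card_profiles_sub_survivors // subUset sA.
Qed.

Lemma mem_survivor_family n (A : {set 'I_n.+2}) :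
  (A \in survivor_family n) =
    (0 < #|[set r : profile n | survivors r == A]|)%N.
Proof.
apply/imsetP/card_gt0P => [[r _ ->] | [r /[!inE] /eqP <-]].
  by exists r; rewrite inE.
by exists r.
Qed.

Theorem theorem7 (n : nat) (hn : (1 <= n)%N) :
  (forall A : {set 'I_n.+2}, A \subset ground n ->
     Rcount A = #|[set r : profile n | survivors r == A]|%:Z
     /\ (A \in survivor_family n <-> 0 < Rcount A))
  /\ (num_survivor_sets n)%:Z =
       \sum_(A : {set 'I_n.+2} | A \subset ground n) Num.min 1 (Rcount A).
Proof.
split=> [A sA | ].
  by rewrite Rcount_card // mem_survivor_family ltz_nat.
have subF A : A \in survivor_family n -> A \subset ground n.
  by move=> /imsetP[r _ ->]; apply: survivors_sub_ground.
rewrite /num_survivor_sets -sum1_card -natz natr_sum big_mkcond [RHS]big_mkcond /=.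
apply: eq_bigr => A _.
case: ifPn => [AF | nAF]; last first.
  case: ifP => // sA; rewrite Rcount_card //.
  by move: nAF; rewrite mem_survivor_family -eqn0Ngt => /eqP ->.
rewrite subF // Rcount_card ?subF //.
by apply/esym/min_idPl; rewrite lez_nat -mem_survivor_family.
Qed.
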